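(* For real $t$ put $\mathfrak m(it)=\int_0^1 e^{ixt}\,\mathrm d?(x)$, where $?$ is the Minkowski question mark function, and let $$\eta_*=\sup\{\eta\ge0:\ |\mathfrak m(it)|=O(|t|^{-\eta})\ \text{as } |t|\to\infty\}$$ be the optimal Fourier decay exponent. Let $D_2$ be the correlation dimension of the Minkowski measure. Then $$\eta_*\le\frac{D_2}{2}.$$
   Context: The Minkowski question mark function $?:[0,1]\to[0,1]$ is the continuous increasing function defined by $?(0)=0$ and, using the continued fraction $x=[0,a_1,a_2,\ldots]=\cfrac{1}{a_1+\cfrac{1}{a_2+\cdots}}$ with $a_j\in\mathbb N=\{1,2,\ldots\}$, by $$?([0,a_1,a_2,\ldots])=2\sum_{j\ge1}(-1)^{j+1}2^{-(a_1+\cdots+a_j)}$$ (for rational $x$ the continued fraction and the sum are finite). The Minkowski measure is the Borel probability measure on $[0,1]$ with distribution function $?$, and $\int\cdot\,\mathrm d?(x)$ is the integral against it. Its correlation dimension is $$D_2=-\lim_{N\to\infty}\frac{\log\Sigma_N}{\log N},\qquad \Sigma_N=\sum_{j=0}^{N-1}\Bigl(?\bigl(\tfrac{j+1}{N}\bigr)-?\bigl(\tfrac jN\bigr)\Bigr)^2$$ (this limit exists and lies in $(0,1)$). *)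

(* Defs.v *)
From HB Require Import structures.
From mathcomp Require Import all_boot all_order all_algebra.
From mathcomp Require Import complex.
From mathcomp Require Import all_classical all_reals all_analysis.

Set Implicit Arguments.
Unset Strict Implicit.
Unset Printing Implicit Defensive.

Import Order.TTheory GRing.Theory Num.Theory.
Import numFieldNormedType.Exports.

Local Open Scope classical_set_scope.
Local Open Scope ring_scope.

Section MinkowskiQuestionMark.
Context {R : realType}.
Implicit Types x t : R.

(* The continued fraction of x in [0, 1] is computed by iterating the Gauss map
   x |-> 1/x - floor(1/x).  The expansion terminates when an iterate is 0;
   since 0^-1 = 0, all the later iterates are then 0 as well. *)
Definition gauss_map x : R := x^-1 - (Num.floor x^-1)%:~R.

Definition cf_rem x (j : nat) : R := iter j gauss_map x.

(* Indices are shifted by one: [cf_digit x j] is a_(j+1) in x = [0, a_1, ...].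
   It is a genuine digit only if [cf_rem x j != 0]. *)
Definition cf_digit x (j : nat) : nat := Num.truncn (cf_rem x j)^-1.

Definition question_term x (j : nat) : R :=
  if cf_rem x j == 0 then 0
  else (-1) ^+ j * 2 ^- (\sum_(k < j.+1) cf_digit x k)%N.

(* The series is a finite sum for rational x, and converges absolutely
   otherwise because all the digits are then positive. *)
Definition question_mark x : R := 2 * limn (series (question_term x)).

(* Together with [mu setT = 1], the values at 0 and 1 force [mu] to be
   concentrated on `[0, 1]. *)
Definition is_minkowski_measure (mu : probability (measurableTypeR R) R) : Prop :=
  forall x, 0 <= x <= 1 -> mu `]-oo, x]%classic = (question_mark x)%:E.

Definition expi (theta : R) : R[i] := (cos theta +i* sin theta)%C.

Definition complex_integral (mu : {measure set (measurableTypeR R) -> \bar R})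
    (D : set R) (f : R -> R[i]) : R[i] :=
  ((\int[mu]_(x in D) complex.Re (f x))
   +i* (\int[mu]_(x in D) complex.Im (f x)))%C.

Definition fourier_transform (mu : probability (measurableTypeR R) R) t : R[i] :=
  complex_integral mu `[0, 1] (fun x => expi (x * t)).

(* |m(it)| = O(|t|^(-eta)) as |t| -> oo, on both sides at once. *)
Definition fourier_decay (mu : probability (measurableTypeR R) R) (eta : R) : Prop :=
  exists C M : R, forall t : R, M <= `|t| ->
    Normc.normc (fourier_transform mu t) <= C * `|t| `^ (- eta).

(* The supremum is taken in the extended reals, so that it is +oo, and not the
   default value of [sup], if the set is unbounded. *)
Definition optimal_decay_exponent (mu : probability (measurableTypeR R) R) : \bar R :=
  ereal_sup [set eta%:E | eta in [set eta : R | 0 <= eta /\ fourier_decay mu eta]].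

Definition Sigma2 (N : nat) : R :=
  \sum_(j < N)
    (question_mark (j.+1%:R / N%:R) - question_mark (j%:R / N%:R)) ^+ 2.

Definition is_correlation_dimension (D2 : R) : Prop :=
  (fun N : nat => - (ln (Sigma2 N) / ln N%:R)) @ \oo --> D2.

End MinkowskiQuestionMark.

(* Main.v *)
Require Import Defs.
From mathcomp Require Import all_boot all_order all_algebra.
From mathcomp Require Import all_classical all_reals all_analysis.
From mathcomp Require Import complex measurable_realfun.
From mathcomp Require Import ring lra zify.

(* Suppose |m(it)| = O(|t|^(-eta)).  Testing the measure against the Fejer-type kernel
   |sum_(k < N) e^(i k (x - y))|^2, which is at least of order N^2 on every cell
   ](j/N), ((j+1)/N)], gives N Sigma_N = O(1 + sum_(1 <= i < N) i^(-2 eta)).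

   If 2 eta < 1 the right-hand side is O(N^(1 - 2 eta)), hence D_2 >= 2 eta; the case
   2 eta = 1 follows by letting the exponent increase to 1.

   If 2 eta > 1 then N Sigma_N would be bounded.  This is impossible: the 2^n Farey
   intervals of depth n all have measure 2^(-n), so if N is a common multiple of the
   denominators, then Cauchy-Schwarz on each of them bounds N Sigma_N from below by
   4^(-n) times the sum of the inverse lengths q q', which grows at least like (9/2)^n. *)

Set Implicit Arguments.
Unset Strict Implicit.
Unset Printing Implicit Defensive.

Import Order.TTheory GRing.Theory Num.Theory.
Import numFieldNormedType.Exports.

Local Open Scope classical_set_scope.
Local Open Scope ring_scope.

(** * Continued fraction digits and convergence of the series for ? *)

Section QuestionMark.
Context {R : realType}.
Implicit Types x : R.

Lemma gauss_map0 : gauss_map (0 : R) = 0.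
Proof. by rewrite /gauss_map invr0 floor0 subr0. Qed.

Lemma cf_remS x j : cf_rem x j.+1 = cf_rem (gauss_map x) j.
Proof. by rewrite /cf_rem iterSr. Qed.

Lemma cf_digitS x j : cf_digit x j.+1 = cf_digit (gauss_map x) j.
Proof. by rewrite /cf_digit cf_remS. Qed.

Lemma cf_rem0 j : cf_rem (0 : R) j = 0.
Proof. by elim: j => // j IH; rewrite cf_remS gauss_map0. Qed.

Lemma gauss_map_itv x : 0 <= gauss_map x <= 1.
Proof.
have := floor_itv x^-1; rewrite /gauss_map intrD => /andP[h1 h2].
apply/andP; split; lra.
Qed.

Lemma cf_rem_itv x j : 0 <= x <= 1 -> 0 <= cf_rem x j <= 1.
Proof.
move=> hx; case: j => // j; rewrite /cf_rem iterS; exact: gauss_map_itv.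
Qed.

Lemma cf_rem_neq0 x i j : (i <= j)%N -> cf_rem x j != 0 -> cf_rem x i != 0.
Proof.
move=> ij; apply: contra_neq => hi.
rewrite /cf_rem -(subnK ij) iterD; rewrite /cf_rem in hi; rewrite hi.
exact: cf_rem0.
Qed.

Lemma cf_digit_gt0 x j : 0 <= x <= 1 -> cf_rem x j != 0 -> (0 < cf_digit x j)%N.
Proof.
move=> /(cf_rem_itv j) /andP[h0 h1] hn.
rewrite /cf_digit truncn_ge_nat ?invr_ge0//.
by rewrite invf_ge1// lt_def hn.
Qed.

Lemma sum_cf_digit_ge x j : 0 <= x <= 1 -> cf_rem x j != 0 ->
  (j < \sum_(k < j.+1) cf_digit x k)%N.
Proof.
move=> hx hj; rewrite -[X in (X <= _)%N]card_ord -sum1_card leq_sum// => k _.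
by apply: cf_digit_gt0 => //; apply: cf_rem_neq0 hj; rewrite -ltnS.
Qed.

(** All digits up to a nonzero remainder are at least 1, so the exponent of 2 exceeds [j]. *)
Lemma normr_question_term_le x j : 0 <= x <= 1 ->
  `|question_term x j| <= geometric 1 (2^-1) j.
Proof.
move=> hx; rewrite /question_term /=; case: ifPn => hj.
  by rewrite normr0 mul1r exprn_ge0.
rewrite normrM normrX normrN1 expr1n !mul1r ger0_norm ?invr_ge0 ?exprn_ge0//.
rewrite -exprVn; apply: ler_wiXn2l => //; first lra.
exact/ltnW/sum_cf_digit_ge.
Qed.

Lemma is_cvg_series_question_term x : 0 <= x <= 1 ->
  cvgn (series (question_term x)).
Proof.
move=> hx; apply: normed_cvg; apply: (series_le_cvg (v_ := geometric 1 (2^-1))).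
- by move=> n /=.
- by move=> n; rewrite /= mul1r exprn_ge0.
- by move=> n; apply: normr_question_term_le.
- by apply: is_cvg_geometric_series; rewrite ger0_norm//; lra.
Qed.

(** * Boundary values and functional equations of ? *)

Lemma question_mark0 : question_mark (0 : R) = 0.
Proof.
rewrite /question_mark; have -> : series (question_term (0 : R)) = cst 0.
  apply/funext => n; rewrite /series /=; apply: big1 => i _.
  by rewrite /question_term cf_rem0 eqxx.
by rewrite lim_cst ?mulr0.
Qed.

(** The reciprocal of x/(1+x) is 1/x + 1: the first digit grows by one and the others stay, so every
    term of the series is halved. *)
Lemma question_mark_div1D x : 0 <= x <= 1 ->
  question_mark (x / (1 + x)) = question_mark x / 2.
Proof.
move=> hx; have [->|x0] := eqVneq x 0; first by rewrite mul0r question_mark0 mul0r.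
have xgt0 : 0 < x by rewrite lt_def x0; case/andP: hx.
set y := x / (1 + x).
have y0 : y != 0 by rewrite mulf_neq0// invr_neq0//; lra.
have yV : y^-1 = x^-1 + 1 by rewrite /y; field; rewrite x0/=; lra.
have gy : gauss_map y = gauss_map x.
  rewrite /gauss_map yV floorDrz ?int_num1//.
  by rewrite floor1 intrD; lra.
have dy : cf_digit y 0 = (cf_digit x 0).+1.
  rewrite /cf_digit /cf_rem/= yV.
  by rewrite addrC truncnD ?nat_num1 ?truncn1 ?add1n// nnegrE invr_ge0 ltW.
have qy : question_term y = 2^-1 *: question_term x.
  apply/funext => j; rewrite -[RHS]/(2^-1 * question_term x j) /question_term.
  have -> : (cf_rem y j == 0) = (cf_rem x j == 0).
    by case: j => [|j]; [rewrite /cf_rem/= (negbTE x0) (negbTE y0)|rewrite !cf_remS gy].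
  case: ifP => _; first by rewrite mulr0.
  rewrite !big_ord_recl dy addSn exprS invfM.
  under eq_bigr do rewrite cf_digitS gy -cf_digitS.
  by rewrite mulrCA.
by rewrite /question_mark qy lim_seriesZ; [rewrite /GRing.scale/=; lra|exact: is_cvg_series_question_term].
Qed.

(** Passing to 1/(1+x) prepends the digit 1, which contributes 1/2 and multiplies the old series by
    -1/2. For x = 1 the first digit would be 2 instead. *)
Lemma question_mark_inv1D_lt1 x : 0 <= x < 1 ->
  question_mark (1 + x)^-1 = 1 - question_mark x / 2.
Proof.
move=> /andP[x0 x1]; set y := (1 + x)^-1.
have y0 : y != 0 by rewrite invr_neq0//; lra.
have fl : Num.floor (1 + x) = 1.
  by apply: floor_def; rewrite lerDl x0/= intrD; lra.
have gy : gauss_map y = x by rewrite /gauss_map invrK fl; lra.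
have dy : cf_digit y 0 = 1%N.
  by rewrite /cf_digit /cf_rem/= invrK; apply: truncn_def; rewrite lerDl x0/=; lra.
have qy0 : question_term y 0 = 2^-1.
  by rewrite /question_term {1}/cf_rem/= (negbTE y0) big_ord1 dy expr0 mul1r expr1.
have qyS j : question_term y j.+1 = - 2^-1 * question_term x j.
  rewrite /question_term cf_remS gy; case: ifP => _; first by rewrite mulr0.
  rewrite big_ord_recl dy add1n 2!exprS invfM.
  under eq_bigr do rewrite cf_digitS gy.
  by ring.
have cx : cvgn (series (question_term x)).
  by apply: is_cvg_series_question_term; rewrite x0/= ltW.
rewrite /question_mark.
suff -> : limn (series (question_term y)) = 2^-1 + - 2^-1 * limn (series (question_term x)) by lra.
apply/cvg_lim => //; rewrite -cvg_shiftS.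
have -> : [sequence series (question_term y) n.+1]_n =
   cst 2^-1 + - 2^-1 *: series (question_term x).
  apply/funext => n; rewrite /series /= big_nat_recl// qy0.
  rewrite -[RHS]/(2^-1 + - 2^-1 * \sum_(0 <= k < n) question_term x k).
  by rewrite mulr_sumr; congr (_ + _); exact: eq_bigr.
by apply: cvgD; [exact: cvg_cst|exact: cvgZr].
Qed.

Lemma question_mark1 : question_mark (1 : R) = 1.
Proof.
have := @question_mark_inv1D_lt1 0; rewrite lexx ltr01 => /(_ isT).
by rewrite addr0 invr1 question_mark0 mul0r subr0.
Qed.

Lemma question_mark_inv1D x : 0 <= x <= 1 ->
  question_mark (1 + x)^-1 = 1 - question_mark x / 2.
Proof.
(* At x = 1 both maps give 1/2, so the other functional equation applies. *)
move=> /andP[x0]; rewrite le_eqVlt => /orP[/eqP->|x1]; last first.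
  by apply: question_mark_inv1D_lt1; rewrite x0.
have := @question_mark_div1D 1; rewrite mul1r question_mark1 => ->; lra.
Qed.

(** * Farey intervals and the lower bound for N Sigma_N *)

Lemma question_mark_mediant (p q p' q' : nat) :
  (0 < q)%N -> (0 < q')%N -> (p' <= q')%N -> (p' * q = p * q' + 1)%N ->
  question_mark ((p + p')%:R / (q + q')%:R : R) =
  (question_mark (p%:R / q%:R : R) + question_mark (p'%:R / q'%:R : R)) / 2.
Proof.
(* Euclidean descent: away from the pair (0/1, 1/1), a Farey pair lies on one side of
   1/2, so it is the image of a smaller one under x / (1 + x) or 1 / (1 + x). *)
have [n] := ubnP (q + q')%N.
elim: n => // n IH in p q p' q' *; rewrite ltnS => hn q0 q0' pq' det.
have pq : (p < q)%N by nia.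
have p'0 : (0 < p')%N by nia.
have qR : 0 < q%:R :> R by rewrite ltr0n.
have qR' : 0 < q'%:R :> R by rewrite ltr0n.
(* For a/b at most 1/2, a/b = x/(1+x) with x = a/(b-a); [step1] treats a/b at least 1/2 as 1/(1+x)
   with x = (b-a)/a. *)
have step0 (a b : nat) : (a < b)%N ->
    question_mark (a%:R / b%:R : R) = question_mark (a%:R / (b - a)%:R : R) / 2 \/
    (b < 2 * a)%N.
  move=> ab; have [h|h] := leqP (2 * a) b; [left|by right].
  have ba : 0 < (b - a)%:R :> R by rewrite ltr0n subn_gt0.
  rewrite -question_mark_div1D; last first.
    by rewrite divr_ge0//= ler_pdivrMr// mul1r ler_nat; lia.
  congr question_mark; rewrite -{1}(subnKC (ltnW ab)) natrD.
  have := ler0n R a; move: (b - a)%N ba => c c0 a0.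
  by field; rewrite !gt_eqF//=; lra.
have step1 (a b : nat) : (0 < a)%N -> (b <= 2 * a)%N -> (a <= b)%N ->
    question_mark (a%:R / b%:R : R) = 1 - question_mark ((b - a)%:R / a%:R : R) / 2.
  move=> a0 h ab; have aR : 0 < a%:R :> R by rewrite ltr0n.
  rewrite -question_mark_inv1D; last first.
    by rewrite divr_ge0//= ler_pdivrMr// mul1r ler_nat; lia.
  congr question_mark; rewrite -{1}(subnKC ab) natrD.
  have := ler0n R (b - a); move: (b - a)%N => c c0.
  by field; rewrite !gt_eqF//=; lra.
have [h|h] := leqP (2 * p') q'.
  have hp : (2 * p <= q)%N by nia.
  have p'q1 : (p' < q')%N by lia.
  have [->|] := step0 _ _ pq; last by lia.
  have [->|] := step0 _ _ p'q1; last by lia.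
  have [|->|] := step0 (p + p')%N (q + q')%N; [by lia| |by lia].
  rewrite (_ : (q + q' - (p + p')) = (q - p) + (q' - p'))%N; last by lia.
  rewrite IH; [by lra|by lia|by lia|by lia|by lia|nia].
(* Both fractions lie in the right half; 1/(1+x) is decreasing, so the smaller Farey pair comes in
   swapped order. *)
have [h'|h'] := leqP q (2 * p).
  rewrite (step1 p q) ?(step1 p' q') ?(step1 (p + p')%N (q + q')%N) //; try lia.
  rewrite (_ : (q + q' - (p + p')) = (q' - p') + (q - p))%N; last by lia.
  rewrite (addnC p p').
  rewrite IH; [by lra|by lia|by lia|by lia|by lia|nia].
(* If 1/2 lies strictly between the fractions, the determinant relation forces q + q' <= 2. *)
have [q1 q'1] : q = 1%N /\ q' = 1%N.
  have := leq_mul h (leqnn q); have := leq_mul h' (leqnn q'); nia.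
have [p0 p'1] : p = 0%N /\ p' = 1%N by subst q q'; lia.
have := @question_mark_div1D 1; rewrite ler01 lexx => /(_ isT).
rewrite p0 p'1 q1 q'1 add0n natrD mul0r !divr1 question_mark0 question_mark1 => ->.
lra.
Qed.

(** Cauchy-Schwarz for a telescoping sum; the induction step reduces to (S - c x)^2 >= 0. *)
Lemma sqr_sum_le_size_mul_sum_sqr (u : nat -> R) a b : (a <= b)%N ->
  (u b - u a) ^+ 2 <= (b - a)%:R * \sum_(a <= j < b) (u j.+1 - u j) ^+ 2.
Proof.
move=> /subnKC <-; rewrite addKn; elim: (b - a)%N => [|n IH].
  by rewrite addn0 subrr expr0n mul0r.
rewrite addnS big_nat_recr ?leq_addr//=.
have Q0 : 0 <= \sum_(a <= j < a + n) (u j.+1 - u j) ^+ 2.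
  by apply: sumr_ge0 => j _; exact: sqr_ge0.
move: IH Q0; move: (\sum_(_ <= j < _) _) => Q IH Q0.
set x := u (a + n).+1 - u (a + n)%N.
have -> : u (a + n).+1 - u a = (u (a + n)%N - u a) + x by rewrite /x; ring.
move: (u (a + n)%N - u a) x IH => S x {u}.
rewrite -[n.+1]addn1 natrD; have := ler0n R n; rewrite le_eqVlt => /orP[/eqP<- h|].
  have -> : S = 0 by apply/eqP; rewrite -sqrf_eq0 eq_le sqr_ge0 andbT; lra.
  by rewrite !add0r mul1r lerDr.
move: (n%:R) => c c0 h.
suff : 0 <= Q + c * x ^+ 2 - 2 * S * x by nra.
rewrite -(pmulr_rge0 _ c0); have := sqr_ge0 (S - c * x); nra.
Qed.

(* The sum of [q * q'] over the [2 ^ n] Farey intervals of depth [n] below one with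
   endpoint denominators [x], [y]. *)
Fixpoint farey_weight (n : nat) (x y : R) : R :=
  if n is n'.+1 then farey_weight n' x (x + y) + farey_weight n' (x + y) y
  else x * y.

(* On quadratic forms a x y + b (x^2 + y^2) the recursion is
   (a, b) |-> (2a + 4b, a + 3b), and it expands (3, 2) by at least 9/2 > 4. *)
Lemma farey_weight_ge n x y : 0 <= x -> 0 <= y ->
  (9 / 2) ^+ n / 2 * (3 * (x * y) + 2 * (x ^+ 2 + y ^+ 2)) <= farey_weight n.+1 x y.
Proof.
elim: n x y => [|n IH] x y x0 y0.
  by rewrite /= expr0; nra.
have xy0 : 0 <= x + y by rewrite addr_ge0.
have -> : farey_weight n.+2 x y =
  farey_weight n.+1 x (x + y) + farey_weight n.+1 (x + y) y by [].
apply: le_trans (lerD (IH _ _ x0 xy0) (IH _ _ xy0 y0)).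
rewrite exprSr; have : 0 <= (9 / 2 : R) ^+ n by apply: exprn_ge0; lra.
move: ((9 / 2) ^+ n) => c c0.
have : 0 <= c * (x * y) by rewrite mulr_ge0// mulr_ge0.
nra.
Qed.

(** Induction on the depth: the mediant halves the ?-measure, and the sum of the two denominators at
    most doubles, whence the bound [(q + q') * 2 ^ n]. Divisibility puts all Farey endpoints on the
    grid of step 1/N, so cells are never cut. *)
Lemma farey_energy (N n k p q p' q' : nat) :
  (0 < N)%N -> (0 < q)%N -> (0 < q')%N -> (p' <= q')%N -> (p' * q = p * q' + 1)%N ->
  question_mark (p'%:R / q'%:R : R) - question_mark (p%:R / q%:R : R) = 2^-1 ^+ k ->
  (forall d, (0 < d)%N -> (d <= (q + q') * 2 ^ n)%N -> (d %| N)%N) ->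
  farey_weight n q%:R q'%:R * 4^-1 ^+ (n + k) <=
  N%:R * \sum_(p * (N %/ q) <= j < p' * (N %/ q'))
    (question_mark (j.+1%:R / N%:R) - question_mark (j%:R / N%:R : R)) ^+ 2.
Proof.
move=> N0; elim: n k p q p' q' => [|n IH] k p q p' q' q0 q0' pq' det hF hd.
- have /dvdnP[m Nm] : (q %| N)%N by apply: hd => //; lia.
  have /dvdnP[m' Nm'] : (q' %| N)%N by apply: hd => //; lia.
  have -> : (N %/ q = m)%N by rewrite Nm mulnK.
  have -> : (N %/ q' = m')%N by rewrite Nm' mulnK.
  (* Since p'/q' - p/q = 1/(q q'), the interval consists of exactly N/(q q') cells. *)
  have e1 : (p * m * (q * q') = p * q' * N)%N by rewrite Nm; ring.
  have e2 : (p' * m' * (q * q') = (p * q' + 1) * N)%N by rewrite -det Nm'; ring.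
  have ab : (p * m <= p' * m')%N.
    by rewrite -(leq_pmul2r (_ : 0 < q * q'))%N ?muln_gt0 ?q0// e1 e2 leq_mul2r leq_addr orbT.
  have ba : ((p' * m' - p * m) * (q * q') = N)%N.
    by rewrite mulnBl e1 e2 -mulnBl addKn mul1n.
  have eqF a b c : (0 < b)%N -> N = (c * b)%N ->
      question_mark ((a * c)%:R / N%:R : R) = question_mark (a%:R / b%:R).
    move=> b0 e; congr question_mark; rewrite e !natrM.
    have c0 : (0 < c)%N by nia.
    by field; rewrite !pnatr_eq0 -!lt0n b0.
  have := sqr_sum_le_size_mul_sum_sqr (fun j => question_mark (j%:R / N%:R)) ab.
  rewrite (eqF p' q' m')// (eqF p q m)// hF /= add0n.
  move: (\sum_(_ <= j < _) _) => S h.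
  rewrite -natrM -ba [X in _ <= X * _]natrM [leLHS]mulrC [leRHS]mulrAC.
  rewrite ler_pM2r ?ltr0n ?muln_gt0 ?q0//.
  by move: h; rewrite -exprM mulnC exprM expr2 -invfM -natrM.
- set M := (_ %/ _)%N; set M' := (_ %/ _)%N.
  pose m := (N %/ (q + q'))%N.
  have qq0 : (0 < q + q')%N by lia.
  have le1 : ((q + q') <= (q + q') * 2 ^ n.+1)%N by rewrite leq_pmulr// expn_gt0.
  have NM : N = (M * q)%N by rewrite divnK// hd//; lia.
  have NM' : N = (M' * q')%N by rewrite divnK// hd//; lia.
  have Nm : N = (m * (q + q'))%N by rewrite divnK// hd//; lia.
  have lec : (p * M <= (p + p') * m)%N.
    rewrite -(leq_pmul2r (_ : 0 < q * (q + q')))%N; last by rewrite muln_gt0 q0.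
    have -> : (p * M * (q * (q + q')) = p * (q + q') * N)%N by rewrite NM; ring.
    have -> : ((p + p') * m * (q * (q + q')) = (p + p') * q * N)%N by rewrite Nm; ring.
    by apply: leq_mul => //; nia.
  have lec' : ((p + p') * m <= p' * M')%N.
    rewrite -(leq_pmul2r (_ : 0 < q' * (q + q')))%N; last by rewrite muln_gt0 q0'.
    have -> : (p' * M' * (q' * (q + q')) = p' * (q + q') * N)%N by rewrite NM'; ring.
    have -> : ((p + p') * m * (q' * (q + q')) = (p + p') * q' * N)%N by rewrite Nm; ring.
    by apply: leq_mul => //; nia.
  have med := @question_mark_mediant p q p' q' q0 q0' pq' det.
  rewrite (big_cat_nat lec lec')/= mulrDr mulrDl -!natrD addSnnS.
  apply: lerD; apply: IH => //.
  + nia.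
  + nia.
  + by rewrite med exprSr -hF; lra.
  + by move=> d d0 hle; apply: hd => //; apply: leq_trans hle _; rewrite expnS; nia.
  + nia.
  + by rewrite med exprSr -hF; lra.
  + by move=> d d0 hle; apply: hd => //; apply: leq_trans hle _; rewrite expnS; nia.
Qed.

(** Start from the pair 0/1, 1/1; the factorial is divisible by every integer up to (1 + 1) 2^n. *)
Lemma Sigma2_ge_farey_weight n :
  farey_weight n 1 1 * 4^-1 ^+ n <= (2 ^ n.+1)`!%:R * Sigma2 (2 ^ n.+1)`!.
Proof.
set N := (2 ^ n.+1)`!; have N0 : (0 < N)%N by exact: fact_gt0.
have := @farey_energy N n 0 0 1 1 1 N0; rewrite !divn1 !mul0n !mul1n !addn0.
rewrite big_mkord => h; apply: h => //.
  by rewrite mul0r divr1 question_mark1 question_mark0 subr0.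
by move=> d d0 hd; apply: dvdn_fact; rewrite d0/= expnS.
Qed.

(** The increments add up to 1, so N Sigma_N >= 1 by Cauchy-Schwarz. Positivity allows taking
    logarithms later. *)
Lemma Sigma2_gt0 N : (0 < N)%N -> 0 < Sigma2 N :> R.
Proof.
move=> N0; have NR : 0 < N%:R :> R by rewrite ltr0n.
have := sqr_sum_le_size_mul_sum_sqr (fun j => question_mark (j%:R / N%:R : R)) (leq0n N).
rewrite big_mkord mul0r divff ?gt_eqF// question_mark0 question_mark1 subr0 subn0.
by rewrite expr1n -(pmulr_rgt0 _ NR); apply: lt_le_trans.
Qed.

(* Equivalently, the Minkowski measure has no square-integrable density. *)
Lemma mul_Sigma2_unbounded (A : R) : exists N, (0 < N)%N /\ A < N%:R * Sigma2 N.
Proof.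
(* The lower bound will be (7/8) (9/8)^n, and (9/8)^n >= (n+1)/8 by [bern]; this explains 64/7. *)
have [n hn] : exists n : nat, A * (64 / 7) < n.+1%:R.
  exists (Num.truncn `|A * (64 / 7)|).
  by rewrite (le_lt_trans (ler_norm _))// truncnS_gt.
exists (2 ^ n.+2)`!; split; first exact: fact_gt0.
apply: lt_le_trans (Sigma2_ge_farey_weight n.+1).
have := @farey_weight_ge n 1 1 ler01 ler01; rewrite !mulr1 !expr1n => hw.
have q0 : 0 < (4^-1 : R) ^+ n.+1 by rewrite exprn_gt0.
apply: (@lt_le_trans _ _ ((9/2) ^+ n / 2 * (3 + 2 * (1 + 1)) * 4^-1 ^+ n.+1)); last first.
  by rewrite ler_pM2r.
have bern : n.+1%:R <= 8 * (9/8 : R) ^+ n.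
  elim: n {hn hw q0} => [|n IH]; first by rewrite expr0; lra.
  rewrite exprS -natr1; have : 1 <= (9/8 : R) ^+ n by apply: exprn_ege1; lra.
  lra.
have -> : (9/2 : R) ^+ n / 2 * (3 + 2 * (1 + 1)) * 4^-1 ^+ n.+1 = 7 / 8 * (9 / 8) ^+ n.
  have -> : (9/8 : R) = 9/2 * 4^-1 by lra.
  by rewrite exprS (exprMn _ (9 / 2)); lra.
lra.
Qed.

End QuestionMark.

(** * The Fejer-type kernel and its double integral *)

Section Fourier.
Context {R : realType}.
Implicit Types x t : R.

Lemma cos_ge_cos1 x : `|x| <= 1 -> cos 1 <= cos x.
Proof.
rewrite -(cos_norm x); move: `|x| (normr_ge0 x) => {}x x0 x1.
have [c hc /eqP] : exists2 c : R, c \in `[x, 1] & cos 1 - cos x = - sin c * (1 - x).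
  apply: (@MVT_segment _ _ (fun c => - sin c)) => //.
  by apply: continuous_subspaceT; exact: continuous_cos.
move: hc; rewrite in_itv/= => /andP[xc c1].
rewrite mulNr => /eqP e.
have : 0 <= sin c * (1 - x).
  apply: mulr_ge0; last lra.
  by apply: sin_ge0_pi; rewrite (le_trans x0 xc)/= (le_trans c1)// (le_trans _ (pi_ge2 R))//; lra.
lra.
Qed.

(** Real form of |sum_(k < N) e^(i k x)|^2, which shows that the kernel is nonnegative. *)
Lemma sum_cos_diff (N : nat) (x : R) :
  \sum_(k < N) \sum_(l < N) cos ((k%:R - l%:R) * x) =
  (\sum_(k < N) cos (k%:R * x)) ^+ 2 + (\sum_(k < N) sin (k%:R * x)) ^+ 2.
Proof.
rewrite !expr2 !mulr_suml -big_split/=; apply: eq_bigr => k _.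
rewrite !mulr_sumr -big_split/=; apply: eq_bigr => l _.
by rewrite mulrBl cosB.
Qed.

(** All phases k x lie in [-1, 1], so each cosine is at least cos 1; the sine square is dropped. *)
Lemma sum_cos_diff_ge (N : nat) (x : R) : `|N%:R * x| <= 1 ->
  (cos 1 * N%:R) ^+ 2 <= \sum_(k < N) \sum_(l < N) cos ((k%:R - l%:R) * x).
Proof.
move=> hx; rewrite sum_cos_diff; apply: ler_wpDr; first exact: sqr_ge0.
have h : cos 1 * N%:R <= \sum_(k < N) cos (k%:R * x).
  rewrite mulr_natr -[N in _ *+ N]card_ord -sumr_const; apply: ler_sum => k _.
  apply: cos_ge_cos1; apply: le_trans hx; rewrite !normrM !normr_nat.
  by apply: ler_wpM2r => //; rewrite ler_nat ltnW.
have c0 : 0 <= cos 1 * N%:R :> R by rewrite mulr_ge0// ltW// cos1_gt0.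
by rewrite ler_sqr ?nnegrE// (le_trans c0).
Qed.

Context (mu : probability (measurableTypeR R) R).
Let D : set (measurableTypeR R) := `[0, 1]%classic.

Let mD : measurable D. Proof. exact: measurable_itv. Qed.

Let c (t : R) : R := \int[mu]_(x in D) cos (x * t).
Let s (t : R) : R := \int[mu]_(x in D) sin (x * t).

Let mu_lty (A : set (measurableTypeR R)) : measurable A -> (mu A < +oo)%E.
Proof. by move=> mA; apply: le_lt_trans (probability_le1 mu mA) _; rewrite ltry. Qed.

Lemma integrable_bounded (f : R -> R) (B : R) : measurable_fun setT f ->
  (forall x, `|f x| <= B) -> mu.-integrable D (EFin \o f).
Proof.
move=> mf fB; apply: measurable_bounded_integrable => //; first exact: mu_lty.
  exact: measurable_funTS.
exists B; split; first exact: num_real.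
by move=> M BM x _; apply: le_trans (fB x) (ltW BM).
Qed.

Lemma integrable_cos t : mu.-integrable D (EFin \o (fun x => cos (x * t))).
Proof.
apply: (@integrable_bounded _ 1); last by move=> x; exact: cos_max.
apply: continuous_measurable_fun => x.
apply: continuous_comp; first exact: mulrr_continuous.
exact: continuous_cos.
Qed.

Lemma integrable_sin t : mu.-integrable D (EFin \o (fun x => sin (x * t))).
Proof.
apply: (@integrable_bounded _ 1); last by move=> x; exact: sin_max.
apply: continuous_measurable_fun => x.
apply: continuous_comp; first exact: mulrr_continuous.
exact: continuous_sin.
Qed.

Lemma integrable_indicR (A : set (measurableTypeR R)) : measurable A ->
  mu.-integrable D (EFin \o (\1_A : R -> R)).
Proof.
move=> mA; apply: (@integrable_bounded _ 1); first exact: measurable_indic.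
by move=> x; rewrite indicE; case: (x \in A); rewrite ?normr1 ?normr0.
Qed.

Lemma Rintegral_indic (A : set (measurableTypeR R)) : measurable A ->
  \int[mu]_(x in D) (\1_A x : R) = fine (mu (A `&` D)).
Proof. by move=> mA; rewrite /Rintegral integral_indic. Qed.

Lemma integrable_sumR (I : Type) (r : seq I) (f : I -> R -> R) :
  (forall i, mu.-integrable D (EFin \o f i)) ->
  mu.-integrable D (EFin \o (fun x => \sum_(i <- r) f i x)).
Proof.
move=> hf; rewrite (_ : _ \o _ = fun x => (\sum_(i <- r) (EFin \o f i) x)%E).
  by apply: integrable_sum => // i _; exact: hf.
by apply/funext => x /=; rewrite sumEFin.
Qed.

Lemma Rintegral_sum (I : Type) (r : seq I) (f : I -> R -> R) :
  (forall i, mu.-integrable D (EFin \o f i)) ->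
  \int[mu]_(x in D) (\sum_(i <- r) f i x) = \sum_(i <- r) \int[mu]_(x in D) f i x.
Proof.
move=> hf; elim: r => [|i r IH].
  by under eq_Rintegral do rewrite big_nil; rewrite Rintegral_cst// mul0r big_nil.
under eq_Rintegral do rewrite big_cons.
rewrite RintegralD//; last exact: integrable_sumR.
by rewrite big_cons IH.
Qed.

Lemma integrableZlR (a : R) (f : R -> R) : mu.-integrable D (EFin \o f) ->
  mu.-integrable D (EFin \o (fun x => a * f x)).
Proof.
move=> hf; rewrite (_ : _ \o _ = fun x => (a%:E * (EFin \o f) x)%E); last first.
  by apply/funext => x.
exact: integrableZl.
Qed.

Lemma integrableDR (f g : R -> R) : mu.-integrable D (EFin \o f) ->
  mu.-integrable D (EFin \o g) -> mu.-integrable D (EFin \o (fun x => f x + g x)).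
Proof.
move=> hf hg; rewrite (_ : _ \o _ = (EFin \o f) \+ (EFin \o g))%E; last first.
  by apply/funext => x.
exact: integrableD.
Qed.

Lemma integrable_cosB (x t : R) :
  mu.-integrable D (EFin \o (fun y => cos (t * (x - y)))).
Proof.
rewrite (_ : (fun y => _) = fun y => cos (x * t) * cos (y * t) + sin (x * t) * sin (y * t)).
  apply: integrableDR; apply: integrableZlR.
    exact: integrable_cos.
  exact: integrable_sin.
by apply/funext => y; rewrite mulrBr cosB !(mulrC t).
Qed.

(** The addition formula separates the variables; integrating again in x gives c^2 + s^2 =
    |m(it)|^2. *)
Lemma Rintegral_cosB (x t : R) :
  \int[mu]_(y in D) cos (t * (x - y)) = cos (x * t) * c t + sin (x * t) * s t.
Proof.
under eq_Rintegral do rewrite mulrBr cosB !(mulrC t).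
rewrite RintegralD// ?RintegralZl//; do ?apply: integrableZlR.
all: by [exact: integrable_cos|exact: integrable_sin].
Qed.

Lemma normc_fourier_transform_sqr t :
  Normc.normc (fourier_transform mu t) ^+ 2 = c t ^+ 2 + s t ^+ 2.
Proof. by rewrite /= sqr_sqrtr// addr_ge0// sqr_ge0. Qed.

(* Both sides are compared with the double integral of the Fejer-type kernel
   [|sum_(k < N) e^(i k (x - y))| ^ 2], which is nonnegative, and at least
   [(cos 1 * N) ^ 2] on every cell. *)
Lemma sum_cell_sqr_le (N : nat) : (0 < N)%N ->
  (cos 1 * N%:R) ^+ 2 *
    \sum_(j < N) fine (mu (`](j%:R / N%:R), (j.+1%:R / N%:R)]%classic `&` D)) ^+ 2 <=
  \sum_(k < N) \sum_(l < N)
     Normc.normc (fourier_transform mu (k%:R - l%:R)) ^+ 2.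
Proof.
move=> N0; have NR : 0 < N%:R :> R by rewrite ltr0n.
pose I (j : nat) : set (measurableTypeR R) := `](j%:R / N%:R), (j.+1%:R / N%:R)]%classic.
have mI j : measurable (I j) by exact: measurable_itv.
pose m j := fine (mu (I j `&` D)).
pose K (x : R) : R := \sum_(k < N) \sum_(l < N) cos ((k%:R - l%:R) * x).
pose G (x : R) : R := \sum_(k < N) \sum_(l < N)
  (c (k%:R - l%:R) * cos (x * (k%:R - l%:R)) + s (k%:R - l%:R) * sin (x * (k%:R - l%:R))).
have K0 x : 0 <= K x by rewrite /K sum_cos_diff addr_ge0// sqr_ge0.
have iK x : mu.-integrable D (EFin \o (fun y => K (x - y))).
  apply: integrable_sumR => k; apply: integrable_sumR => l.
  exact: integrable_cosB.
have GE x : G x = \int[mu]_(y in D) K (x - y).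
  rewrite Rintegral_sum; last first.
    by move=> k; apply: integrable_sumR => l; exact: integrable_cosB.
  apply: eq_bigr => k _; rewrite Rintegral_sum; last by move=> l; exact: integrable_cosB.
  by apply: eq_bigr => l _; rewrite Rintegral_cosB !(mulrC (cos _)) !(mulrC (sin _)).
have G0 x : 0 <= G x by rewrite GE; apply: Rintegral_ge0.
(* Two points of one cell satisfy N |x - y| <= 1, so the kernel is large there; off the cell it is
   nonnegative. *)
have Gm j x : I j x -> (cos 1 * N%:R) ^+ 2 * m j <= G x.
  move=> Ix; rewrite GE /m -Rintegral_indic// -RintegralZl//; last exact: integrable_indicR.
  apply: le_Rintegral => //; first exact/integrableZlR/integrable_indicR.
  move=> y _; rewrite indicE; case: (boolP (y \in I j)) => [|_]; last by rewrite mulr0.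
  rewrite inE => Iy; rewrite mulr1; apply: sum_cos_diff_ge.
  move: Ix Iy; rewrite /I/= !in_itv/= !ltr_pdivrMr// !ler_pdivlMr// -natr1 !(mulrC _ N%:R).
  by rewrite mulrBr ler_norml; lra.
have iterm k l : mu.-integrable D (EFin \o (fun x => c (k%:R - l%:R) * cos (x * (k%:R - l%:R)) +
      s (k%:R - l%:R) * sin (x * (k%:R - l%:R)))).
  by apply: integrableDR; apply: integrableZlR; [exact: integrable_cos|exact: integrable_sin].
have -> : \sum_(k < N) \sum_(l < N) Normc.normc (fourier_transform mu (k%:R - l%:R)) ^+ 2
   = \int[mu]_(x in D) G x.
  rewrite Rintegral_sum; last by move=> k; apply: integrable_sumR => l; exact: iterm.
  apply: eq_bigr => k _; rewrite Rintegral_sum; last by move=> l; exact: iterm.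
  apply: eq_bigr => l _; rewrite normc_fourier_transform_sqr RintegralD//.
  - rewrite !RintegralZl//; [exact: integrable_sin|exact: integrable_cos].
  - exact/integrableZlR/integrable_cos.
  - exact/integrableZlR/integrable_sin.
have -> : (cos 1 * N%:R) ^+ 2 * \sum_(j < N) m j ^+ 2 =
   \int[mu]_(x in D) (\sum_(j < N) (cos 1 * N%:R) ^+ 2 * m j * \1_(I j) x).
  rewrite Rintegral_sum; last by move=> j; exact/integrableZlR/integrable_indicR.
  rewrite mulr_sumr; apply: eq_bigr => j _.
  by rewrite RintegralZl ?Rintegral_indic//; [rewrite mulrA|exact: integrable_indicR].
apply: le_Rintegral => //.
- by apply: integrable_sumR => j; exact/integrableZlR/integrable_indicR.
- by apply: integrable_sumR => k; apply: integrable_sumR => l; exact: iterm.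
move=> x _.
(* Outside all cells, as at x = 0, the step function vanishes. Otherwise disjointness of the
   half-open cells leaves one term. *)
have [[j Ij]|nI] := pselect (exists j : 'I_N, I j x); last first.
  rewrite big1 ?G0// => j _; rewrite indicE (memNset (A := I j)) ?mulr0// => Ij; apply: nI; by exists j.
rewrite (bigD1 j)//= big1 ?addr0.
  by rewrite indicE mem_set// mulr1 Gm.
move=> i ij; rewrite indicE (memNset (A := I i)) ?mulr0// => Ii; move/eqP: ij; apply.
move: Ii Ij; rewrite /I/= !in_itv/= => /andP[h1 h2] /andP[h3 h4].
have := lt_le_trans h1 h4; have := lt_le_trans h3 h2.
rewrite !ltr_pM2r ?invr_gt0// !ltr_nat !ltnS => ij ji.
by apply/val_inj/eqP; rewrite eqn_leq ij ji.
Qed.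

End Fourier.

(** * Sums over distances and dyadic blocks *)

Section Sums.
Context {R : realType}.

(** With truncated subtraction the argument of [b] is |k - l|; each positive distance occurs at most
    twice. *)
Lemma sum_dist_le (b : nat -> R) (N k : nat) : (forall i, 0 <= b i) -> (k < N)%N ->
  \sum_(l < N) b ((k - l) + (l - k))%N <= b 0 + 2 * \sum_(i < N.-1) b i.+1.
Proof.
move=> b0 kN; pose B n := \sum_(0 <= i < n) b i.+1.
have Bmono m n : (m <= n)%N -> B m <= B n.
  by move=> mn; rewrite /B (big_cat_nat (leq0n m) mn)/= lerDl sumr_ge0.
have h1 : \sum_(0 <= l < k) b ((k - l) + (l - k))%N = B k.
  rewrite big_nat_rev /B; apply: eq_big_nat => i /andP[_ ik]; congr b; lia.
have h2 : \sum_(k.+1 <= l < N) b ((k - l) + (l - k))%N = B (N - k.+1)%N.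
  rewrite -{1}[k.+1]add0n big_addn; apply: eq_big_nat => i _; congr b; lia.
rewrite -(big_mkord xpredT (fun l => b ((k - l) + (l - k))%N)).
rewrite -(big_mkord xpredT (fun i => b i.+1)).
rewrite (big_cat_nat (leq0n k) (ltnW kN))/= (big_ltn kN) subnn addn0 h1 h2.
have /Bmono l1 : (k <= N.-1)%N by lia.
have /Bmono l2 : (N - k.+1 <= N.-1)%N by lia.
rewrite -/(B N.-1); lra.
Qed.

(** The block 2^i <= n < 2^(i+1) has 2^i terms, each at most 2^(-i s). *)
Lemma sum_powR_dyadic_le (s : R) (m : nat) : 0 <= s ->
  \sum_(i < (2 ^ m).-1) i.+1%:R `^ (- s) <= \sum_(i < m) (2 * 2 `^ (- s)) ^+ i.
Proof.
move=> s0; rewrite -(big_mkord xpredT (fun i => i.+1%:R `^ (- s))).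
elim: m => [|m IH]; first by rewrite expn0 big_geq// big_ord0.
have m0 : (0 < 2 ^ m)%N by rewrite expn_gt0.
have mm : ((2 ^ m).-1 <= (2 ^ m.+1).-1)%N by rewrite expnS; lia.
rewrite (big_cat_nat (leq0n _) mm)/= big_ord_recr/=; apply: lerD => //.
apply: (@le_trans _ _ (\sum_((2 ^ m).-1 <= i < (2 ^ m.+1).-1) (2 ^ m)%:R `^ (- s))).
  apply: ler_sum_nat => i /andP[hi _]; rewrite !powRN lef_pV2 ?posrE ?powR_gt0 ?ltr0n//.
  by apply: ge0_ler_powR => //; rewrite ?nnegrE// ler_nat; lia.
rewrite sumr_const_nat (_ : (_ - _ = 2 ^ m)%N); last by rewrite expnS; lia.
rewrite -[leLHS]mulr_natl exprMn natrX ler_pM2l ?exprn_gt0//.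
by rewrite -(powR_mulrn m (powR_ge0 _ _)) -(powR_mulrn m (ler0n R 2)) powRAC.
Qed.

Lemma ln2_gt0 : 0 < ln 2 :> R.
Proof. by rewrite ln_gt0// ltr1n. Qed.

(** Whether the dyadic ratio exceeds 1 is thus decided by the sign of 1 - s. *)
Lemma two_mul_powRN (s : R) : 2 * 2 `^ (- s) = expR ((1 - s) * ln 2).
Proof.
by rewrite /powR pnatr_eq0/= -[X in X * _]lnK ?posrE// -expRD mulrBl mul1r mulNr.
Qed.

End Sums.

(** * From Fourier decay to bounds on Sigma_N and D_2 *)

Section Decay.
Context {R : realType} (mu : probability (measurableTypeR R) R)
  (hmu : is_minkowski_measure mu).
Local Notation normm t := (Normc.normc (fourier_transform mu t)).

Lemma minkowski_cell (N j : nat) : (j < N)%N ->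
  fine (mu (`](j%:R / N%:R), (j.+1%:R / N%:R)]%classic `&` `[0, 1]%classic)) =
  question_mark (j.+1%:R / N%:R) - question_mark (j%:R / N%:R).
Proof.
move=> jN; have NR : 0 < N%:R :> R by rewrite ltr0n (leq_ltn_trans _ jN).
have itv i : (i <= N)%N -> 0 <= (i%:R / N%:R : R) <= 1.
  by move=> iN; rewrite divr_ge0//= ler_pdivrMr// mul1r ler_nat.
have /andP[a0 a1] := itv j (ltnW jN); have /andP[b0 b1] := itv j.+1 jN.
have ab : j%:R / N%:R <= j.+1%:R / N%:R :> R by rewrite ler_pM2r ?invr_gt0// ler_nat.
move: a0 a1 b0 b1 ab; move: (j%:R / N%:R) (j.+1%:R / N%:R) => a b a0 a1 b0 b1 ab.
rewrite setIidl; last first.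
  by move=> x /=; rewrite !in_itv/= => /andP[xa xb]; apply/andP; split; lra.
have U : `]-oo, b]%classic = `]-oo, a]%classic `|` `]a, b]%classic :> set R.
  by rewrite -itv_bndbnd_setU// bnd_simp.
have : mu `]-oo, b]%classic = (mu `]-oo, a]%classic + mu `]a, b]%classic)%E.
  rewrite U measureU//; apply/seteqP; split => x //=.
  by rewrite !in_itv/= => -[xa /andP[]]; rewrite ltNge xa.
rewrite !hmu ?a0 ?b0//.
have : mu `]a, b]%classic \is a fin_num by exact: fin_num_measure.
by move=> /fineK <-; rewrite -EFinD => -[->]; rewrite addrC addKr.
Qed.

(** Crude bound, 1 for each component; it serves the diagonal k = l and the frequencies below the
    decay threshold. *)
Lemma normc_fourier_transform_sqr_le2 (t : R) : normm t ^+ 2 <= 2.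
Proof.
rewrite normc_fourier_transform_sqr.
have mD : measurable (`[0, 1]%classic : set (measurableTypeR R)) by exact: measurable_itv.
have bnd (f : R -> R) : (forall x, `|f x| <= 1) ->
    mu.-integrable `[0, 1]%classic (EFin \o f) ->
    (\int[mu]_(x in `[0, 1]) f x) ^+ 2 <= 1.
  move=> f1 fi; rewrite -real_normK ?num_real//; apply: exprn_ile1 => //.
  apply: le_trans (le_normr_Rintegral mD fi) _.
  apply: (@le_trans _ _ (\int[mu]_(x in `[0, 1]) 1)).
    apply: le_Rintegral => //.
    - exact: (integrable_norm fi).
    - by apply: (@integrable_bounded _ _ _ 1) => // x; rewrite normr1.
  rewrite Rintegral_cst// mul1r -lee_fin fineK ?probability_le1//.
  exact: fin_num_measure.
apply: (@le_trans _ _ (1 + 1)); last by [].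
apply: lerD; apply: bnd; do ?[by move=> x; exact: cos_max|by move=> x; exact: sin_max].
  exact: integrable_cos.
exact: integrable_sin.
Qed.

Lemma fourier_decay_sqr (eta s : R) : fourier_decay mu eta -> 0 <= s -> s <= 2 * eta ->
  exists2 A : R, 0 < A & forall t : R, 1 <= `|t| -> normm t ^+ 2 <= A * `|t| `^ (- s).
Proof.
(* The first summand handles |t| >= M; the second handles |t| < M, where |t|^(-s) >= (|M| +
   1)^(-s). *)
move=> [C [M hCM]] s0 se; exists (C ^+ 2 + 2 * (`|M| + 1) `^ s).
  by rewrite ltr_wpDl ?sqr_ge0// mulr_gt0// powR_gt0// ltr_wpDl.
move=> t t1; have tp : 0 < `|t| by rewrite (lt_le_trans _ t1).
rewrite mulrDl; have [Mt|tM] := leP M `|t|.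
  apply: ler_wpDr; first by rewrite mulr_ge0 ?mulr_ge0 ?powR_ge0.
  have nn : 0 <= normm t by exact: sqrtr_ge0.
  apply: (@le_trans _ _ ((C * `|t| `^ (- eta)) ^+ 2)).
    by rewrite ler_sqr ?nnegrE//; [exact: hCM|exact: le_trans (hCM _ Mt)].
  rewrite exprMn; apply: ler_wpM2l; first exact: sqr_ge0.
  rewrite -powR_mulrn ?powR_ge0// -powRrM; apply: ler_powR => //; lra.
apply: ler_wpDl; first by rewrite mulr_ge0 ?powR_ge0 ?sqr_ge0.
apply: (le_trans (normc_fourier_transform_sqr_le2 t)).
rewrite -mulrA ler_peMr// powRN ler_pdivlMr ?powR_gt0// mul1r.
apply: ge0_ler_powR => //; rewrite ?nnegrE// ?addr_ge0//.
by have := ler_norm M; lra.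
Qed.

Lemma fourier_decay_Sigma2_le (eta s : R) : fourier_decay mu eta -> 0 <= s -> s <= 2 * eta ->
  exists2 A : R, 0 < A & forall m N : nat, (0 < N)%N -> (N <= 2 ^ m)%N ->
  N%:R * Sigma2 N <= A * (1 + \sum_(i < m) (2 * 2 `^ (- s)) ^+ i).
Proof.
move=> hd s0 se; have [A A0 hA] := fourier_decay_sqr hd s0 se.
have c1 : 0 < cos 1 ^+ 2 :> R by rewrite exprn_gt0// cos1_gt0.
(* 2 comes from the diagonal, 2 A from the two signs of k - l, and cos 1 from the kernel. *)
exists ((2 + 2 * A) / cos 1 ^+ 2); first by rewrite divr_gt0// addr_gt0// mulr_gt0.
move=> m N N0 Nm; have NR : 0 < N%:R :> R by rewrite ltr0n.
set S := \sum_(i < m) _.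
pose b (i : nat) : R := if i is i'.+1 then A * i'.+1%:R `^ (- s) else 2.
have b0 i : 0 <= b i by case: i => //= i; rewrite mulr_ge0 ?powR_ge0// ltW.
have hb (k l : nat) : normm (k%:R - l%:R) ^+ 2 <= b ((k - l) + (l - k))%N.
  have [kl|lk|->] := ltngtP k l.
  - have -> : (k - l + (l - k) = (l - k).-1.+1)%N by lia.
    rewrite /b; set d := (l - k).-1.+1.
    have e : `|k%:R - l%:R| = d%:R :> R.
      rewrite distrC -natrB ?(ltnW kl)// normr_nat; congr (_%:R); rewrite /d; lia.
    by rewrite -e; apply: hA; rewrite e ler1n.
  - have -> : (k - l + (l - k) = (k - l).-1.+1)%N by lia.
    rewrite /b; set d := (k - l).-1.+1.
    have e : `|k%:R - l%:R| = d%:R :> R.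
      rewrite -natrB ?(ltnW lk)// normr_nat; congr (_%:R); rewrite /d; lia.
    by rewrite -e; apply: hA; rewrite e ler1n.
  - by rewrite subnn; exact: normc_fourier_transform_sqr_le2.
have BS : \sum_(i < N.-1) b i.+1 <= A * S.
  rewrite /b -mulr_sumr; apply: ler_wpM2l; first exact: ltW.
  apply: le_trans (sum_powR_dyadic_le m s0).
  rewrite -(big_mkord xpredT (fun i => i.+1%:R `^ (- s))).
  rewrite -(big_mkord xpredT (fun i => i.+1%:R `^ (- s))).
  have le1 : (N.-1 <= (2 ^ m).-1)%N by lia.
  by rewrite (big_cat_nat (leq0n _) le1)/= lerDl; apply: sumr_ge0 => i _; rewrite powR_ge0.
have S0 : 0 <= S.
  by apply: sumr_ge0 => i _; rewrite exprn_ge0// mulr_ge0// powR_ge0.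
have := sum_cell_sqr_le mu N0.
under eq_bigr do rewrite minkowski_cell ?ltn_ord//.
rewrite -/(Sigma2 N) => h.
have : (cos 1 * N%:R) ^+ 2 * Sigma2 N <= N%:R * (2 + 2 * (A * S)).
  apply: le_trans h _; rewrite mulr_natl -[X in _ *+ X]card_ord -sumr_const.
  apply: ler_sum => k _; apply: (@le_trans _ _ (\sum_(l < N) b ((k - l) + (l - k))%N)).
    by apply: ler_sum => l _; exact: hb.
  apply: le_trans (sum_dist_le b0 (ltn_ord k)) _.
  by apply: lerD => //; rewrite ler_pM2l.
have -> : (cos 1 * N%:R) ^+ 2 * Sigma2 N = N%:R * (cos 1 ^+ 2 * (N%:R * Sigma2 N)) :> R.
  by ring.
rewrite ler_pM2l// => {}h.
rewrite mulrAC ler_pdivlMr// mulrC; apply: le_trans h _.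
have := mulr_ge0 (ltW A0) S0; nra.
Qed.

(** For 2 eta > 1 the ratio r is below 1, so N Sigma_N stays below a multiple of 1 + 1/(1 - r),
    against [mul_Sigma2_unbounded]. *)
Lemma fourier_decay_le_half (eta : R) : fourier_decay mu eta -> eta <= 1 / 2.
Proof.
move=> hd; rewrite leNgt; apply/negP => he.
have [|A A0 hA] := @fourier_decay_Sigma2_le eta (2 * eta) hd _ (lexx _); first lra.
pose r : R := 2 * 2 `^ (- (2 * eta)).
have r0 : 0 <= r by rewrite mulr_ge0// powR_ge0.
have r1 : r < 1.
  by rewrite /r two_mul_powRN expR_lt1 pmulr_llt0 ?ln2_gt0// subr_lt0; lra.
have [N [N0]] := mul_Sigma2_unbounded (A * (1 + (1 - r)^-1)).
apply/negP; rewrite -leNgt; apply: le_trans (hA N N N0 (ltnW (ltn_expl _ _))) _ => //.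
rewrite ler_pM2l// lerD2l -/r.
have := subrX1 r N => e.
rewrite -[leRHS]mul1r ler_pdivlMr ?subr_gt0//.
have := exprn_ge0 N r0; lra.
Qed.

Lemma fourier_decay_le_correlation_dimension (eta s D2 : R) :
  is_correlation_dimension D2 -> fourier_decay mu eta ->
  0 <= s -> s <= 2 * eta -> s < 1 -> s <= D2.
Proof.
move=> hD2 hd s0 se s1.
have [A A0 hA] := fourier_decay_Sigma2_le hd s0 se.
pose r : R := 2 * 2 `^ (- s).
have r1 : 1 < r.
  by rewrite /r two_mul_powRN expR_gt1 mulr_gt0 ?ln2_gt0// subr_gt0.
(* As r > 1, both 1 and the geometric sum are absorbed: 1 + (r^m - 1)/(r - 1) <= (1 + 1/(r - 1))
   r^m. *)
pose A' := A * (1 + (r - 1)^-1).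
have A'0 : 0 < A' by rewrite mulr_gt0// addr_gt0// invr_gt0 subr_gt0.
have ln2 := @ln2_gt0 R.
have bound m : Sigma2 (2 ^ m) <= A' * (2 `^ (- s)) ^+ m.
  have m0 : (0 < 2 ^ m)%N by rewrite expn_gt0.
  rewrite -(@ler_pM2l _ (2 ^ m)%:R) ?ltr0n//.
  apply: le_trans (hA m _ m0 (leqnn _)) _.
  rewrite mulrCA natrX -exprMn -/r /A' -mulrA ler_pM2l//.
  have := subrX1 r m => e; have := exprn_ege1 m (ltW r1) => h.
  rewrite mulrDl mul1r; apply: lerD => //.
  rewrite mulrC ler_pdivlMr ?subr_gt0// mulrC; lra.
(* The limit is tested along N = 2^(m+1); the shift keeps ln N nonzero and makes the error term a
   multiple of [harmonic]. *)
have h2 : (fun m : nat => 2 ^ m.+1)%N @ \oo --> \oo.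
  apply/cvgnyPge => B; near=> m.
  apply: leq_trans (ltnW (ltn_expl m.+1 (leqnn 2))); apply: leqW.
  by near: m; exact: nbhs_infty_ge.
have lim2 := cvg_comp _ _ h2 hD2.
have lim1 : (fun m => s - ln A' / ln 2 * harmonic m) @ \oo --> s.
  rewrite -[X in _ --> X]subr0 -[X in _ --> _ - X](mulr0 (ln A' / ln 2)).
  by apply: cvgB; [exact: cvg_cst|apply: cvgMr; exact: cvg_harmonic].
apply: (ler_cvg_to lim1 lim2); apply: nearW => m /=.
have Sp : 0 < Sigma2 (2 ^ m.+1) :> R by rewrite Sigma2_gt0// expn_gt0.
have P0 : 0 < (2 `^ (- s)) ^+ m.+1 :> R by rewrite exprn_gt0// powR_gt0.
have : ln (Sigma2 (2 ^ m.+1)) <= ln A' - s * (m.+1%:R * ln 2).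
  apply: (@le_trans _ _ (ln (A' * (2 `^ (- s)) ^+ m.+1))).
    by rewrite ler_ln; [exact: bound|rewrite posrE|rewrite posrE mulr_gt0].
  by rewrite lnM ?posrE// lnXn ?powR_gt0// ln_powR -[X in _ + X]mulr_natl; lra.
rewrite natrX lnXn// -(mulr_natl (ln 2)) => h.
have m0 : 0 < m.+1%:R * ln 2 :> R by rewrite mulr_gt0.
rewrite -[leRHS]mulNr ler_pdivlMr// /harmonic/=.
rewrite mulrBl.
have -> : ln A' / ln 2 * m.+1%:R^-1 * (m.+1%:R * ln 2) = ln A'.
  by field; apply/andP; split; apply: lt0r_neq0 => //; rewrite ltr_pwDl.
lra.
Unshelve. all: by end_near.
Qed.

End Decay.

Theorem mainTheorem4 (R : realType)
  (mu : probability (measurableTypeR R) R) (hmu : is_minkowski_measure mu)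
  (D2 : R) (hD2 : is_correlation_dimension D2) :
  (optimal_decay_exponent mu <= (D2 / 2)%R%:E)%E.
Proof.
apply: ub_ereal_sup => _ [eta [eta0 hd] <-]; rewrite lee_fin.
(* Only 2 eta <= 1 remains, so every exponent s < 2 eta satisfies s < 1. *)
have le_half := fourier_decay_le_half hmu hd.
have key s := @fourier_decay_le_correlation_dimension R mu hmu eta s D2 hD2 hd.
suff : 2 * eta <= D2 by lra.
have [lt1|ge1] := ltP (2 * eta) 1; first by apply: key => //; lra.
apply/ler_addgt0Pr => e e0; rewrite -lerBlDr.
(* In the borderline case 2 eta = 1 the exponent is lowered by e; the maximum keeps it nonnegative
   for large e. *)
apply: (@le_trans _ _ (Num.max 0 (2 * eta - e))); first by rewrite le_max lexx orbT.
by apply: key; rewrite ?le_max ?lexx// ?ge_max ?gt_max; lra.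
Qed.
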